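(* Let $c_n$ be the number of $FU_k$-equivalence classes of the set $\mathcal{L}_n$ of Łukasiewicz paths of length $n$. Then $\sum_{n\geq0}c_nx^n=\frac{2}{1-x+\sqrt{1-2x+x^2-4x^3}}$, which is also the generating function of the numbers of $U_kF$-equivalence classes of $\mathcal{L}_n$.
   Context: A Łukasiewicz path of length $n$ is a sequence of $n$ steps from $\{(1,i): i\geq -1\}$ starting at $(0,0)$, ending at $(n,0)$ and never going below the $x$-axis. Write $D=(1,-1)$, $F=(1,0)$, $U_k=(1,k)$ for $k\geq1$. Steps are numbered $1,\dots,n$; an occurrence of a two-step pattern is at position $i$ if its first step is the $i$-th step. Two Łukasiewicz paths of the same length are $FU_k$-equivalent (resp. $U_kF$-equivalent) if for every $k\geq1$ the set of occurrence positions of $FU_k$ (resp. $U_kF$) is the same in both. *)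

(* Defs.v *)
From HB Require Import structures.
From mathcomp Require Import all_boot all_order all_algebra.
From mathcomp Require Import boolp.

Set Implicit Arguments.
Unset Strict Implicit.
Unset Printing Implicit Defensive.

Import Order.TTheory GRing.Theory Num.Theory.
Local Open Scope ring_scope.

(* The step (1, i) is encoded by its second coordinate i : int. *)
Definition stepF : int := 0.
Definition stepU (k : nat) : int := k%:Z.

Definition height (s : seq int) (i : nat) : int := \sum_(x <- take i s) x.

Definition is_lukasiewicz (s : seq int) : bool :=
  [&& all (fun x => -1 <= x) s,
      all (fun i => 0 <= height s i) (iota 0 (size s).+1)
    & height s (size s) == 0].

Record lukasiewicz (n : nat) := Lukasiewicz {
  steps :> n.-tuple int;
  _ : is_lukasiewicz steps
}.

HB.instance Definition _ n := [isSub for @steps n].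
HB.instance Definition _ n := [Choice of lukasiewicz n by <:].
HB.instance Definition _ n := [Countable of lukasiewicz n by <:].

Lemma sum_ge_size (s : seq int) :
  all (fun x => -1 <= x) s -> - (size s)%:Z <= \sum_(x <- s) x.
Proof.
elim: s => [|x s IH] /=; first by rewrite big_nil.
case/andP=> hx hs; rewrite big_cons -addn1 PoszD opprD addrC.
by apply: lerD => //; apply: IH.
Qed.

Lemma step_le n (p : lukasiewicz n) (i : 'I_n) : tnth p i <= n%:Z.
Proof.
case: p => s /= /and3P[h1 h2 /eqP h3].
have szs : size s = n by rewrite size_tuple.
have lti : (i < size s)%N by rewrite szs.
rewrite (tnth_nth 0); set x := nth _ _ _.
have e : take i s ++ x :: drop i.+1 s = s by rewrite -drop_nth // cat_take_drop.
move: h3; rewrite /height take_size -[in X in X = _]e big_cat big_cons /= => h3.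
have g1 : 0 <= \sum_(y <- take i s) y.
  by apply: (allP h2 i); rewrite mem_iota leq0n add0n ltnS ltnW.
have g2 : - (size (drop i.+1 s))%:Z <= \sum_(y <- drop i.+1 s) y.
  apply: sum_ge_size; apply/allP => y /mem_drop hy.
  by move/allP: h1; apply.
have g3 : (size (drop i.+1 s))%:Z <= n%:Z.
  by rewrite size_drop szs lez_nat leq_subr.
set a := \sum_(y <- take _ _) _ in h3 g1.
set b := \sum_(y <- drop _ _) _ in h3 g2.
have -> : x = - a - b.
  by move/eqP: h3; rewrite addrCA addr_eq0 opprD => /eqP.
apply: le_trans g3; rewrite -[leRHS]add0r; apply: lerD; first by rewrite oppr_le0.
by rewrite lerNl.
Qed.

Definition encode n (p : lukasiewicz n) : n.-tuple 'I_(n.+2) :=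
  [tuple inord (absz (tnth p i + 1)%R) | i < n].
Definition decode n (t : n.-tuple 'I_(n.+2)) : option (lukasiewicz n) :=
  insub [tuple (tnth t i)%:Z - 1 | i < n].

Lemma encodeK n : pcancel (@encode n) (@decode n).
Proof.
move=> p; rewrite /decode /encode.
rewrite (_ : [tuple _ | i < n] = steps p); first exact: valK.
apply: eq_from_tnth => i; rewrite !tnth_mktuple.
have ge : 0 <= tnth p i + 1.
  case: p => s /= /and3P[/allP h _ _].
  by rewrite -[0](addNr 1) lerD2r; apply: h; apply: mem_tnth.
rewrite inordK; first by rewrite gez0_abs // addrK.
by rewrite ltnS -lez_nat gez0_abs // -addn1 PoszD lerD2r step_le.
Qed.

HB.instance Definition _ n : isFinite (lukasiewicz n) :=
  PCanIsFinite (@encodeK n).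

(* The index j : 'I_n stands for the position j + 1, i.e. for the (j+1)-st
   step.  The bound j + 1 < n is needed: nth pads with 0, which encodes F. *)
Definition positions (a b : int) n (p : lukasiewicz n) : {set 'I_n} :=
  [set j : 'I_n | [&& (j.+1 < n)%N, nth 0 p j == a & nth 0 p j.+1 == b]].

Definition FU_equiv n : rel (lukasiewicz n) := fun p q =>
  `[< forall k : nat, (1 <= k)%N ->
      positions stepF (stepU k) p = positions stepF (stepU k) q >].

Definition UF_equiv n : rel (lukasiewicz n) := fun p q =>
  `[< forall k : nat, (1 <= k)%N ->
      positions (stepU k) stepF p = positions (stepU k) stepF q >].

Lemma FU_equiv_rel n : equivalence_rel (@FU_equiv n).
Proof.
move=> p q r; split; first by apply/asboolP.
move=> /asboolP e.
by apply/asboolP/asboolP => h k k1; [rewrite -e // h | rewrite e // h].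
Qed.

Lemma UF_equiv_rel n : equivalence_rel (@UF_equiv n).
Proof.
move=> p q r; split; first by apply/asboolP.
move=> /asboolP e.
by apply/asboolP/asboolP => h k k1; [rewrite -e // h | rewrite e // h].
Qed.

Definition num_classes (T : finType) (R : rel T) : nat :=
  #|equivalence_partition R [set: T]|.

(* The ring of formal power series over the rationals. *)
Record fps := Fps { coefs :> nat -> rat }.

HB.instance Definition _ := gen_eqMixin fps.
HB.instance Definition _ := gen_choiceMixin fps.

Lemma fpsP (A B : fps) : (forall n, A n = B n) <-> A = B.
Proof.
split=> [h|-> //]; case: A B h => [a] [b] /= h.
by congr Fps; apply/funext.
Qed.

Definition fps_zero := Fps (fun=> 0).
Definition fps_opp (A : fps) := Fps (fun n => - A n).
Definition fps_add (A B : fps) := Fps (fun n => A n + B n).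

Lemma fps_addA : associative fps_add.
Proof. by move=> A B C; apply/fpsP => n /=; rewrite addrA. Qed.
Lemma fps_addC : commutative fps_add.
Proof. by move=> A B; apply/fpsP => n /=; rewrite addrC. Qed.
Lemma fps_add0 : left_id fps_zero fps_add.
Proof. by move=> A; apply/fpsP => n /=; rewrite add0r. Qed.
Lemma fps_addN : left_inverse fps_zero fps_opp fps_add.
Proof. by move=> A; apply/fpsP => n /=; rewrite addNr. Qed.

HB.instance Definition _ :=
  GRing.isZmodule.Build fps fps_addA fps_addC fps_add0 fps_addN.

Definition fps_one := Fps (fun n => (n == 0%N)%:R).
Definition fps_mul (A B : fps) := Fps (fun n => \sum_(i < n.+1) A i * B (n - i)%N).

Definition fps_trunc m (A : fps) : {poly rat} := \poly_(i < m.+1) A i.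

Lemma coef_trunc m A i : (i <= m)%N -> (fps_trunc m A)`_i = A i.
Proof. by move=> h; rewrite coef_poly ltnS h. Qed.

Lemma coef_truncM m A B n : (n <= m)%N ->
  (fps_trunc m A * fps_trunc m B)`_n = fps_mul A B n.
Proof.
move=> h; rewrite coefM; apply: eq_bigr => i _.
have hi : (i <= n)%N by rewrite -ltnS.
by rewrite !coef_trunc // (leq_trans _ h) // leq_subr.
Qed.

Lemma fps_mulA : associative fps_mul.
Proof.
move=> A B C; apply/fpsP => n.
pose t := fps_trunc n.
transitivity ((t A * (t B * t C))`_n).
  rewrite coefM; apply: eq_bigr => i _; have hi : (i <= n)%N by rewrite -ltnS.
  by rewrite coef_trunc // coef_truncM // leq_subr.
rewrite mulrA coefM; apply: eq_bigr => i _; have hi : (i <= n)%N by rewrite -ltnS.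
by rewrite coef_truncM // coef_trunc // leq_subr.
Qed.

Lemma fps_mulC : commutative fps_mul.
Proof.
move=> A B; apply/fpsP => n.
by rewrite -!(@coef_truncM n) // mulrC.
Qed.

Lemma fps_mul1 : left_id fps_one fps_mul.
Proof.
move=> A; apply/fpsP => n /=.
by rewrite big_ord_recl /= mul1r subn0 big1 ?addr0 // => i _; rewrite mul0r.
Qed.

Lemma fps_mulDl : left_distributive fps_mul fps_add.
Proof.
move=> A B C; apply/fpsP => n /=.
by rewrite -big_split; apply: eq_bigr => i _; rewrite mulrDl.
Qed.

Lemma fps_one_neq0 : fps_one != 0.
Proof. by apply/eqP => /fpsP /(_ 0%N). Qed.

HB.instance Definition _ := GRing.Zmodule_isComNzRing.Build fps
  fps_mulA fps_mulC fps_mul1 fps_mulDl fps_one_neq0.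

Lemma coef0M (A B : fps) : (A * B) 0%N = A 0%N * B 0%N.
Proof. by rewrite /= big_ord_recl big_ord0 addr0. Qed.

(* Course-of-values recursion: G maps [:: f 0; ...; f (n-1)] to f n. *)
Fixpoint cv_prefix (G : seq rat -> rat) (n : nat) : seq rat :=
  if n is m.+1 then rcons (cv_prefix G m) (G (cv_prefix G m)) else [::].
Definition cv_rec (G : seq rat -> rat) (n : nat) : rat := G (cv_prefix G n).

Lemma cv_prefixE G n : cv_prefix G n = mkseq (cv_rec G) n.
Proof. by elim: n => // n IH; rewrite mkseqS -IH. Qed.

Lemma cv_recE G n : cv_rec G n = G (mkseq (cv_rec G) n).
Proof. by rewrite -cv_prefixE. Qed.

Definition fps_unit : {pred fps} := fun A : fps => A 0%N != 0.

Definition fps_inv (A : fps) : fps :=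
  if A \in fps_unit then
    Fps (cv_rec (fun s =>
      if size s == 0%N then (A 0%N)^-1
      else - (A 0%N)^-1 * \sum_(i < size s) s`_i * A (size s - i)%N))
  else A.

Lemma fps_mulV : {in fps_unit, left_inverse 1 fps_inv *%R}.
Proof.
move=> A hA; have A0 : A 0%N != 0 by [].
rewrite /fps_inv hA; apply/fpsP; set G := (X in cv_rec X).
case=> [|n]; first by rewrite coef0M /= cv_recE /= mulVf.
rewrite /= big_ord_recr /= subnn [in X in _ + X]cv_recE /G size_mkseq /=.
rewrite -/G mulrAC mulNr mulVf // mulN1r.
apply/eqP; rewrite subr_eq0; apply/eqP; apply: eq_bigr => i _.
by rewrite nth_mkseq.
Qed.

Lemma fps_unitPl (A B : fps) : B * A = 1 -> fps_unit A.
Proof.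
move=> /fpsP /(_ 0%N); rewrite coef0M => h.
by apply/eqP => h0; move/eqP: h; rewrite h0 mulr0 eq_sym oner_eq0.
Qed.

Lemma fps_inv_out : {in [predC fps_unit], fps_inv =1 id}.
Proof. by move=> A; rewrite inE /fps_inv => /negbTE->. Qed.

HB.instance Definition _ := GRing.ComNzRing_hasMulInverse.Build fps
  fps_mulV fps_unitPl fps_inv_out.

(* Square root with constant term 1 of a series with constant term 1: the
   coefficients are read off from S ^+ 2 = A (see fps_sqrtK, fps_sqrt_uniq). *)
Definition fps_sqrt (A : fps) : fps :=
  Fps (cv_rec (fun s =>
    if size s == 0%N then 1
    else (A (size s) - \sum_(1 <= i < size s) s`_i * s`_(size s - i)) / 2)).

Lemma fps_sqrt0 A : fps_sqrt A 0%N = 1.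
Proof. by []. Qed.

Lemma coef_sqr (S : fps) n :
  (S ^+ 2) n.+1 = S 0%N * S n.+1 *+ 2 + \sum_(1 <= i < n.+1) S i * S (n.+1 - i)%N.
Proof.
rewrite expr2 /= -(big_mkord xpredT (fun i => S i * S (n.+1 - i)%N)).
rewrite big_nat_recr //= big_ltn // subn0 subnn [S n.+1 * _]mulrC.
by rewrite addrAC mulr2n.
Qed.

Lemma fps_sqrtK (A : fps) : A 0%N = 1 -> fps_sqrt A ^+ 2 = A.
Proof.
move=> A0; apply/fpsP; case=> [|n].
  by rewrite expr2 coef0M fps_sqrt0 mulr1 A0.
rewrite coef_sqr fps_sqrt0 mul1r -mulr_natr.
rewrite {1}/fps_sqrt [coefs (Fps _) _]cv_recE size_mkseq /= divfK ?pnatr_eq0 //.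
rewrite [X in _ - X](eq_big_nat _ _
  (F2 := fun i => fps_sqrt A i * fps_sqrt A (n.+1 - i)%N)) ?subrK //.
move=> i /andP[i1 i2]; rewrite !nth_mkseq //.
by rewrite ltn_subrL i1.
Qed.

Lemma fps_sqrt_uniq (A S : fps) : S 0%N = 1 -> S ^+ 2 = A -> S = fps_sqrt A.
Proof.
move=> S0 SA; have A0 : A 0%N = 1 by rewrite -SA expr2 coef0M S0 mulr1.
apply/fpsP => n; elim/ltn_ind: n => -[|n] IH; first by rewrite S0.
have /fpsP /(_ n.+1) : S ^+ 2 = fps_sqrt A ^+ 2 by rewrite fps_sqrtK.
rewrite !coef_sqr S0 fps_sqrt0 !mul1r.
rewrite [X in _ + X = _](eq_big_nat _ _
  (F2 := fun i => fps_sqrt A i * fps_sqrt A (n.+1 - i)%N)).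
  by move=> /addIr /eqP; rewrite eqr_pMn2r // => /eqP.
by move=> i /andP[i1 i2]; rewrite !IH // ltn_subrL i1.
Qed.

Definition fpsX : fps := Fps (fun n => (n == 1%N)%:R).

Definition genfun (c : nat -> nat) : fps := Fps (fun n => (c n)%:R).

(* Main.v *)
(* A class is determined by the positions and indices k of the marked pairs
   [F U_k] (resp. [U_k F]), which are disjoint.  As an unmarked step goes down by
   at most 1, in every suffix of the path the sum of the indices of the marked
   pairs is at most the number of unmarked steps.  Conversely, if this holds,
   replace each unmarked step by [D] when the current height is positive and by
   [F] otherwise: no new pattern appears, and the path ends on the axis.  Hence
   both kinds of classes correspond to the same words.

   Read from right to left, such a word is a walk on the nonnegative integers
   with steps +1 (weight x) and -k (weight x^2), k >= 1, ending anywhere.  If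
   C = 1 + x C + x^3 C^2 and r = 1 + x^2 C, the walks starting at h have the
   generating function C r^h. *)
Require Import Defs.
From mathcomp Require Import all_boot all_order all_algebra.
From mathcomp Require Import boolp zify ring.

Set Implicit Arguments.
Unset Strict Implicit.
Unset Printing Implicit Defensive.

Import Order.TTheory GRing.Theory Num.Theory.
Local Open Scope ring_scope.

(** * Reversed paths and their labels *)

Definition total (s : seq int) : int := \sum_(x <- s) x.

Lemma total_nil : total [::] = 0.
Proof. exact: big_nil. Qed.

Lemma total_cons x s : total (x :: s) = x + total s.
Proof. exact: big_cons. Qed.

Lemma total_rev s : total (rev s) = total s.
Proof. by apply: perm_big; rewrite perm_rev. Qed.

(* [r] is a path read from right to left, so that its partial heights are the
   totals of the suffixes of [r]. *)
Fixpoint rev_path (r : seq int) : bool :=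
  if r is x :: r' then [&& -1 <= x, 0 <= x + total r' & rev_path r'] else true.

Lemma rev_path_ge0 (r : seq int) : rev_path r -> 0 <= total r.
Proof. by case: r => [|x r]; rewrite ?total_nil // total_cons /= => /and3P[]. Qed.

Lemma is_lukasiewicz_rev (s : seq int) :
  is_lukasiewicz s = rev_path (rev s) && (total s == 0).
Proof.
rewrite /is_lukasiewicz andbA /height take_size -!/(total _); congr (_ && _).
elim/last_ind: s => [|s x IH]; first by rewrite /= big_nil.
rewrite rev_rcons [rev_path _]/= -IH all_rcons size_rcons -[(size s).+2]addn1.
rewrite iotaD all_cat [all _ (iota (0 + _) _)]/= andbT add0n.
rewrite -[X in take X (rcons _ _)](size_rcons s x) take_size.
rewrite -/(total _) -[total (rcons s x)]total_rev rev_rcons total_cons total_rev.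
rewrite (eq_in_all (a2 := fun i => 0 <= \sum_(y <- take i s) y)).
  by do !case: (_ <= _); rewrite ?andbF ?andbT //.
move=> i; rewrite mem_iota add0n ltnS => /andP[_ hi].
by rewrite -cats1 takel_cat.
Qed.

(* In a path read from right to left, [mark true x y = k] when [x] and [y] form
   an occurrence of [F U_k], and [mark false x y = k] when they form an
   occurrence of [U_k F]; it is [0] when there is no occurrence. *)
Definition mark (b : bool) (x y : int) : nat :=
  let u := if b then x else y in
  let v := if b then y else x in
  if (v == 0) && (0 < u) then absz u else 0%N.

Fixpoint label (b : bool) (r : seq int) : seq nat :=
  if r is x :: r' then (if r' is y :: _ then mark b x y else 0%N) :: label b r'
  else [::].

Lemma size_label b r : size (label b r) = size r.
Proof. by elim: r => //= x r ->. Qed.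

Lemma nth_label b r i :
  nth 0%N (label b r) i =
  if (i.+1 < size r)%N then mark b (nth 0 r i) (nth 0 r i.+1) else 0%N.
Proof.
elim: r i => [|x r IH] [|i] //=.
by case: r {IH}.
Qed.

Lemma label_rev_eq b (s t : seq int) : size s = size t ->
  (label b (rev s) = label b (rev t)) <->
  (forall j, (j.+1 < size s)%N ->
     mark b (nth 0 s j.+1) (nth 0 s j) = mark b (nth 0 t j.+1) (nth 0 t j)).
Proof.
move=> est; split=> [e j hj|h].
  have := congr1 (fun w => nth 0%N w (size s - j.+2)) e.
  have h1 : ((size s - j.+2).+1 < size s)%N by lia.
  have h2 := ltnW h1.
  rewrite !nth_label !size_rev -est h1 !nth_rev -?est //.
  have -> : (size s - (size s - j.+2).+1 = j.+1)%N by lia.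
  by have -> : (size s - (size s - j.+2).+2 = j)%N by lia.
apply: (@eq_from_nth _ 0%N); first by rewrite !size_label !size_rev.
move=> i _; rewrite !nth_label !size_rev -est; case: ltnP => // h1.
have h2 := ltnW h1; rewrite !nth_rev -?est //.
have -> : (size s - i.+1 = (size s - i.+2).+1)%N by lia.
by apply: h; lia.
Qed.

(* [h] is the largest possible height of the path at the current point when it
   is read from right to left: an unmarked step raises the height by at most [1],
   a marked pair of index [k] lowers it by [k]. *)
Fixpoint valid (h : nat) (w : seq nat) : bool :=
  match w with
  | [::] => true
  | 0%N :: w' => valid h.+1 w'
  | k.+1 :: 0%N :: w' => (k < h)%N && valid (h - k.+1) w'
  | _ => false
  end.

(** * Labels of paths are the valid words *)

Lemma mark_sum b x y k : mark b x y = k.+1 -> x + y = k.+1%:Z.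
Proof.
by rewrite /mark; case: b; case: eqP => [->|] //=; case: ltP => // *; lia.
Qed.

(** The shared step [y] would have to be [0] and positive at once; so marked pairs are disjoint. *)
Lemma mark_mark b x y z k : mark b x y = k.+1 -> mark b y z = 0%N.
Proof.
rewrite /mark; case: b.
  by case: eqP => [->|] //= _; rewrite ltxx andbF.
by case: eqP => //= _; case: ltP => // hy _; case: eqP => // y0; lia.
Qed.

Lemma valid_label b (r : seq int) (h : nat) :
  rev_path r -> total r <= h%:Z -> valid h (label b r).
Proof.
have [n] := ubnP (size r).
elim: n r h => // n IH [|x [|y r]] h //=.
rewrite !total_cons ltnS => hn /and3P[hx hxr /and3P[hy hyr hr]] hh.
(* The height left below a marked pair is nonnegative, which gives [k < h]. *)
have ge0 := rev_path_ge0 hr.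
case e: (mark b x y) => [|k].
  by apply: (IH (y :: r)); rewrite //= ?hy ?hyr ?hr ?total_cons //; lia.
have exy := mark_sum e.
have -> : (if r is z :: _ then mark b y z else 0%N) = 0%N.
  by case: (r) => // z _; apply: mark_mark e.
by rewrite IH //; lia.
Qed.

(* The tail of [w] comes first in the path; the unmarked steps go down unless
   the path is on the axis. *)
Fixpoint fill (b : bool) (w : seq nat) : seq int :=
  match w with
  | [::] => [::]
  | 0%N :: w' =>
      let r := fill b w' in (if total r == 0 then 0 else -1) :: r
  | k.+1 :: w1 =>
      if w1 is _ :: w' then
        (if b then [:: k.+1%:Z; 0] else [:: 0; k.+1%:Z]) ++ fill b w'
      else [::]
  end.

(** For [h = 0] the bound on the total and [rev_path_ge0] make the path end on the axis. *)
Lemma fillP b w h : valid h w ->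
  [/\ rev_path (fill b w), total (fill b w) <= h%:Z, label b (fill b w) = w
    & size (fill b w) = size w].
Proof.
have [n] := ubnP (size w).
elim: n w h => // n IH [|[|k] w] h.
- by rewrite /= total_nil.
- move=> /= hn hw; have [||h1 h2 h3 h4] := IH w h.+1 => //.
  have ge0 := rev_path_ge0 h1.
  split; rewrite /= ?h1 ?h3 ?h4 ?total_cons //.
  + by case: eqP => [->|]; rewrite /= ?andbT //; lia.
  + by case: eqP => [->|]; lia.
  (* No new mark: if [b] is [true], it would need the added step to be positive; otherwise the first
     entry of [fill b w], which is [0] or [-1]. *)
  congr (_ :: _).
  case: (w) => [|[|k] w'] //=.
    by rewrite /mark; case: b {IH h1 h2 h3 h4 ge0};
      do !case: ifP => //=; rewrite ?andbF.
  case: w' => // a w'.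
  by rewrite /mark; case: b {IH h1 h2 h3 h4 ge0};
    rewrite /= ?ltxx ?andbF //; case: ifP.
case: w => [|[|//] w] //= hn /andP[hk hw].
have [|h1 h2 h3 h4] := IH w (h - k.+1)%N _ hw; first by lia.
have ge0 := rev_path_ge0 h1.
case: b IH h1 h2 h3 h4 ge0 => IH h1 h2 h3 h4 ge0.
  split; rewrite /= ?h1 ?h3 ?h4 ?total_cons //; try lia.
  by congr [:: _, _ & _]; case: (fill _ _) => // z l; rewrite /mark /= andbF.
split; rewrite /= ?h1 ?h3 ?h4 ?total_cons //; try lia.
by congr [:: _, _ & _]; case: (fill _ _).
Qed.

(** * Enumeration of the valid words *)

Fixpoint words (m h : nat) : seq (seq nat) :=
  if m is m1.+1 then
    map (cons 0%N) (words m1 h.+1) ++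
    (if m1 is m2.+1 then
       [seq [:: (h - j)%N, 0%N & w] | j <- iota 0 h, w <- words m2 j] else [::])
  else [:: [::]].

Lemma mem_words m h w : (w \in words m h) = (size w == m) && valid h w.
Proof.
have [n] := ubnP m; elim: n m h w => // n IH [|m] h w hn; first by case: w.
rewrite [words _ _]/= mem_cat; apply/orP/andP => [[/mapP[v]|]|[]].
- by rewrite IH // => /andP[/eqP <- hv] ->.
- case: m hn => [|m] // hn /allpairsPdep[j [v [hj]]].
  rewrite mem_iota add0n in hj; rewrite IH; last by lia.
  move=> /andP[/eqP <- hv] -> /=.
  have -> : (h - j = (h - j.+1).+1)%N by lia.
  split=> //; apply/andP; split; first by lia.
  by have -> : (h - (h - j.+1).+1 = j)%N by lia.
case: w => [|[|k] w] //= /eqP[sw] hw; subst m.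
  by left; apply/mapP; exists w => //; rewrite IH ?eqxx.
case: w hw hn => [|[|//] w] //= /andP[hk hw] hn.
right; apply/allpairsPdep; exists (h - k.+1)%N, w.
rewrite mem_iota IH ?eqxx ?hw; last by lia.
split=> //; first by lia.
by congr [:: _, _ & _]; lia.
Qed.

Lemma uniq_words m h : uniq (words m h).
Proof.
have [n] := ubnP m; elim: n m h => // n IH [|m] h hn //.
rewrite [words _ _]/= cat_uniq map_inj_uniq ?IH //=; last by move=> ? ? [].
case: m hn => [|m] // hn; apply/andP; split.
  apply/hasPn => w /allpairsPdep[j [v [hj _ ->]]].
  rewrite mem_iota add0n in hj.
  by apply/mapP => -[u _ [e _]]; lia.
apply: allpairs_uniq_dep; first exact: iota_uniq.
  by move=> j _; apply: IH; lia.
move=> u u' /allpairsPdep[j [v [hj _ ->]]] /allpairsPdep[j' [v' [hj' _ ->]]].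
rewrite !mem_iota in hj hj' => /= -[e ->].
by have -> : j = j' by lia.
Qed.

(** * Classes counted by words *)

Lemma num_classesE (T : finType) (U : eqType) (R : rel T) (f : T -> U)
    (s : seq U) :
  (forall p q, R p q = (f p == f q)) -> uniq s ->
  (forall u, reflect (exists p, f p = u) (u \in s)) ->
  num_classes R = size s.
Proof.
move=> Rf us fs.
(* As [s] lists the image of [f], [B] maps it bijectively onto the classes. *)
pose B u := [set q | f q == u].
have memB p u : (p \in B u) = (f p == u) by rewrite inE.
rewrite /num_classes -(size_map B) cardE; apply/perm_size/uniq_perm.
- exact: enum_uniq.
- rewrite map_inj_in_uniq // => u v /fs[p <-] _ e.
  by have := memB p (f p); rewrite e memB eqxx => /eqP.
move=> X; rewrite mem_enum; apply/imsetP/mapP => [[p _ ->]|[u /fs[p <-] ->]].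
  exists (f p); first by apply/fs; exists p.
  by apply/setP => q; rewrite !inE Rf eq_sym.
by exists p => //; apply/setP => q; rewrite !inE Rf eq_sym.
Qed.

Lemma num_classes_label b n (R : rel (lukasiewicz n)) :
  (forall p q, R p q = (label b (rev p) == label b (rev q))) ->
  num_classes R = size (words n 0).
Proof.
move=> hR; apply: (num_classesE hR); first exact: uniq_words.
move=> w; rewrite mem_words; apply: (iffP andP) => [[/eqP hs hw]|[p <-]].
  have [h1 h2 h3 h4] := fillP b hw.
  have hz : size (rev (fill b w)) == n by rewrite size_rev h4 hs.
  have hl : is_lukasiewicz (Tuple hz).
    by rewrite is_lukasiewicz_rev /= revK h1 -/(total _) total_rev
               eq_le h2 rev_path_ge0.
  by exists (Lukasiewicz hl); rewrite /= revK.
case: p => s /=; rewrite is_lukasiewicz_rev => /andP[hr /eqP h0].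
rewrite size_label size_rev size_tuple eqxx; split=> //.
by apply: valid_label => //; rewrite total_rev h0.
Qed.

Lemma eq_positions (a b : nat -> int) (c : bool) n (p q : lukasiewicz n) :
  (forall k x y, (1 <= k)%N -> (x == a k) && (y == b k) = (mark c y x == k)) ->
  (forall k, (1 <= k)%N -> positions (a k) (b k) p = positions (a k) (b k) q)
  <-> label c (rev p) = label c (rev q).
Proof.
move=> hm.
rewrite label_rev_eq ?size_tuple //.
split=> [h j hj|h k k1]; last first.
  apply/setP => j; rewrite !inE; case: ltnP => //= hj.
  by rewrite !hm // h.
(* These tests determine a mark, since [0] is the only value that fails all of them. *)
have key k : (1 <= k)%N ->
    (mark c (nth 0 p j.+1) (nth 0 p j) == k) =
    (mark c (nth 0 q j.+1) (nth 0 q j) == k).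
  move=> k1; have /setP/(_ (Ordinal (ltnW hj))) := h k k1.
  by rewrite !inE /= hj /= !hm.
case e: (mark c (nth 0 p j.+1) (nth 0 p j)) => [|k].
  case e': (mark c (nth 0 q j.+1) (nth 0 q j)) => [|k] //.
  by have := key k.+1 isT; rewrite e e' eqxx.
by have := key k.+1 isT; rewrite e eqxx => /esym/eqP.
Qed.

Lemma FU_equivE n (p q : lukasiewicz n) :
  FU_equiv p q = (label true (rev p) == label true (rev q)).
Proof.
apply/asboolP/eqP => /(@eq_positions (fun=> stepF) stepU); apply=> k x y k1;
  rewrite /stepF /stepU /mark /=; apply/andP/eqP => [[/eqP-> /eqP->]|] /=;
  case: ifP => //=; lia.
Qed.

Lemma UF_equivE n (p q : lukasiewicz n) :
  UF_equiv p q = (label false (rev p) == label false (rev q)).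
Proof.
apply/asboolP/eqP => /(@eq_positions stepU (fun=> stepF)); apply=> k x y k1;
  rewrite /stepF /stepU /mark /=; apply/andP/eqP => [[/eqP-> /eqP->]|] /=;
  case: ifP => //=; lia.
Qed.

(** * Generating functions *)

Lemma coefXM0 (A : fps) : (fpsX * A) 0%N = 0.
Proof. by rewrite Defs.coef0M mul0r. Qed.

Lemma coefXMS (A : fps) n : (fpsX * A) n.+1 = A n.
Proof.
rewrite /= big_ord_recl /= mul0r add0r big_ord_recl /= mul1r subSS subn0.
by rewrite big1 ?addr0 // => i _; rewrite mul0r.
Qed.

Lemma coefsD (A B : fps) n : (A + B) n = A n + B n.
Proof. by []. Qed.

Lemma coefs_sum (I : Type) (s : seq I) (F : I -> fps) n :
  (\sum_(i <- s) F i : fps) n = \sum_(i <- s) F i n.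
Proof. exact: (big_morph (coefs^~ n)). Qed.

(* [r^h = 1 + (r - 1) sum_(j < h) r^j] with [r = 1 + x^2 C], and
   [C = 1 + x C r], so that [C r^h] satisfies the recursion of [words]. *)
Lemma size_words (C : fps) m h :
  C = 1 + fpsX * C + fpsX ^+ 3 * C ^+ 2 ->
  (size (words m h))%:R = (C * (1 + fpsX ^+ 2 * C) ^+ h) m.
Proof.
move=> eC; set r := 1 + _.
have rec k : C * r ^+ k = 1 + fpsX * (C * r ^+ k.+1)
    + fpsX * (fpsX * \sum_(j <- iota 0 k) C * r ^+ j).
  have -> : fpsX * (fpsX * \sum_(j <- iota 0 k) C * r ^+ j) = r ^+ k - 1.
    rewrite subrX1 -(big_mkord xpredT (fun j => r ^+ j)) /index_iota subn0.
    rewrite -mulr_sumr !mulrA; congr (_ * _); rewrite /r; ring.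
  rewrite exprS {1}eC /r; ring.
have [n] := ubnP m; elim: n m h => // n IH [|m] h hn.
  by rewrite rec !coefsD !coefXM0 !addr0.
rewrite rec !coefsD !coefXMS [(1 : fps) _]/= add0r.
rewrite [words _ _]/= size_cat size_map natrD IH //; congr (_ + _).
case: m hn => [|m] hn; first by rewrite coefXM0.
(* [j] is the bound left after a marked pair of index [h - j], hence the geometric sum in [rec]. *)
rewrite coefXMS coefs_sum size_allpairs_dep sumnE big_map natr_sum.
by apply: eq_bigr => j _; apply: IH; lia.
Qed.

Lemma fps_natE n : (n%:R : fps) 0%N = n%:R.
Proof. by elim: n => // n IH; rewrite -addn1 !natrD coefsD IH. Qed.

Lemma fps_unitE (A : fps) : (A \is a GRing.unit) = (A 0%N != 0).
Proof. by []. Qed.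

(** Squaring [C * S = 2 - (1 - x) * C] eliminates the root [S] and leaves four times the equation;
    [4] is a unit. *)
Lemma quadratic_root (x := fpsX)
    (C := 2 / (1 - x + fps_sqrt (1 - 2 * x + x ^+ 2 - 4 * x ^+ 3))) :
  C = 1 + x * C + x ^+ 3 * C ^+ 2.
Proof.
set A := 1 - 2 * x + x ^+ 2 - 4 * x ^+ 3 in C *.
have x0 (B : fps) : (x * B) 0%N = 0 by exact: coefXM0.
have A0 : A 0%N = 1.
  have -> : A = 1 + x * (- 2 + x - 4 * x ^+ 2) by rewrite /A; ring.
  by rewrite coefsD x0 addr0.
pose S := fps_sqrt A; have S2 : S ^+ 2 = A := fps_sqrtK A0.
have CS : C * S = 2 - (1 - x) * C.
  (* The constant term is [1 + 1]. *)
  have U : (1 - x + S) \is a GRing.unit by rewrite fps_unitE.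
  rewrite -[X in X - _](divrK U) -/C; ring.
have U4 : (4 : fps) \is a GRing.unit by rewrite fps_unitE fps_natE.
apply: (mulrI U4); apply/eqP; rewrite -subr_eq0; apply/eqP.
have : (C * S) ^+ 2 = C ^+ 2 * A by rewrite exprMn S2.
rewrite CS => /eqP; rewrite -subr_eq0 => /eqP e.
rewrite -[RHS]oppr0 -e /A; ring.
Qed.

Theorem theorem12 :
  let x := fpsX in
  let C := 2 / (1 - x + fps_sqrt (1 - 2 * x + x ^+ 2 - 4 * x ^+ 3)) in
  genfun (fun n : nat => num_classes (@FU_equiv n)) = C
  /\ genfun (fun n : nat => num_classes (@UF_equiv n)) = C.
Proof.
move=> x C; have eC : C = 1 + x * C + x ^+ 3 * C ^+ 2 := quadratic_root.
split; apply/fpsP => n /=.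
  rewrite (num_classes_label (@FU_equivE n)) (size_words _ _ eC).
  by rewrite expr0 mulr1.
rewrite (num_classes_label (@UF_equivE n)) (size_words _ _ eC).
by rewrite expr0 mulr1.
Qed.
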